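(* For an oriented ordered three-component link $k$ with Gauss diagram $G_k$ (with one base point on each of the three circles), let $$P_{\mathrm{even}}(k)=\frac16\sum_{\sigma\ \mathrm{even}}\big\langle 2B_{ijk}+2C_{ijk}+A_{ijk}+D_{ijk},\,G_k\big\rangle,\qquad P_{\mathrm{odd}}(k)=\frac16\sum_{\sigma\ \mathrm{odd}}\big\langle 2B_{ijk}+2C_{ijk}+A_{ijk}+D_{ijk},\,G_k\big\rangle,$$ where $\sigma=\begin{pmatrix}1&2&3\\ i&j&k\end{pmatrix}$ runs over the even, respectively odd, permutations in $S_3$. Let $\mu=P_{\mathrm{even}}-P_{\mathrm{odd}}$ and $\hat\mu=P_{\mathrm{even}}+P_{\mathrm{odd}}$, and let $t\in\mathbb{Q}$. Then $$(1-t)\,\mu+t\,\hat\mu$$ is a link homotopy invariant of oriented ordered three-component links with fixed base points. If $t=1$, it is a base-point-free invariant (i.e. it does not depend on the choice of base points).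
   Context: Gauss diagrams. Let $k$ be an oriented link in $S^3$ with three ordered components $k_1,k_2,k_3$, given by a link diagram, with a base point (away from crossings) chosen on each component. Its Gauss diagram $G_k$ consists of three oriented circles numbered $1,2,3$ (the parametrizing circles of the components), each with its base point, together with, for every crossing, an arrow joining the two preimages of the crossing, directed from the overpassing to the underpassing preimage and carrying the sign $\pm1$ of the crossing. Pairing. For a based arrow diagram $X$ (three numbered, oriented, based circles with some arrows without signs), $\langle X,G_k\rangle$ is the sum, over all subsets of arrows of $G_k$ which, together with the three numbered based circles, form a diagram isomorphic to $X$ (respecting circle numbers, base points, cyclic order of endpoints along oriented circles, and arrow directions), of the product of the signs of the arrows in the subset. It is extended linearly to linear combinations of arrow diagrams. The four arrow diagrams. For $\{i,j,k\}=\{1,2,3\}$, each of the following has exactly two arrows; the order of the two endpoints on circle $j$ is the order in which they are met when travelling along circle $j$ from its base point in the direction of its orientation (in the pictures, the circles $i,j,k$ are placed from left to right, oriented counterclockwise, with base points on top): - $B_{ijk}$: arrows $i\to j$ and $j\to k$; on circle $j$ the head of $i\to j$ comes first, then the tail of $j\to k$. - $C_{ijk}$: arrows $j\to i$ and $k\to j$; on circle $j$ the tail of $j\to i$ comes first, then the head of $k\to j$. - $A_{ijk}$: arrows $i\to j$ and $k\to j$; on circle $j$ the head of $i\to j$ comes first, then the head of $k\to j$. - $D_{ijk}$: arrows $j\to i$ and $j\to k$; on circle $j$ the tail of $j\to i$ comes first, then the tail of $j\to k$. (Here, as an index of arrow diagrams, $k$ denotes $\sigma(3)\in\{1,2,3\}$;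 elsewhere $k$ denotes the link.) Link homotopy is the equivalence relation on links generated by ambient isotopy and crossing changes between strands of the same component. For links with fixed base points, the moves on diagrams (Reidemeister moves and self-crossing changes) take place away from the base points, i.e. no strand or crossing is moved across a base point. *)

(* Defs.v *)
From Stdlib Require Import Relation_Operators.
From mathcomp Require Import all_boot all_order all_fingroup all_algebra.

Set Implicit Arguments.
Unset Strict Implicit.
Unset Printing Implicit Defensive.

Import GRing.Theory.
Local Open Scope ring_scope.

(* Arrow diagrams on three numbered, oriented, based circles.  An end of an   *)
(* arrow [a] is a pair [(a, b)], with [b = true] for the tail and [b = false] *)
(* for the head.  A based oriented circle is the word of the arrow ends met   *)
(* when travelling along it once from its base point; the circles 1, 2, 3     *)
(* have indices 0, 1, 2 in ['I_3].                                            *)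

Record arrow_diagram := ArrowDiagram {
  arrow : finType;
  circle : 'I_3 -> seq (arrow * bool);
  circleP : forall p, (\sum_(c < 3) count_mem p (circle c) = 1)%N }.

Record gauss_diagram := GaussDiagram {
  unsigned :> arrow_diagram;
  positive : pred (arrow unsigned) }.

Definition sign (G : gauss_diagram) (a : arrow G) : rat :=
  if positive a then 1 else -1.

(* [f] is an isomorphism from [X] to the subdiagram of [Y] formed by the      *)
(* three based circles and the arrows in [S].                                 *)
Definition is_embedding (X Y : arrow_diagram) (S : {set arrow Y})
    (f : {ffun arrow X -> arrow Y}) : bool :=
  [&& injectiveb f, f @: [set: arrow X] == S
    & [forall c, [seq (f p.1, p.2) | p <- circle X c]
                 == [seq p <- circle Y c | p.1 \in S]]].

Definition iso_subdiagram (X Y : arrow_diagram) (S : {set arrow Y}) : bool :=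
  [exists f, is_embedding S (f : {ffun arrow X -> arrow Y})].

Definition gauss_iso_subdiagram (G H : gauss_diagram) (S : {set arrow H}) : bool :=
  [exists f : {ffun arrow G -> arrow H},
    is_embedding S f && [forall a, positive (f a) == positive a]].

Definition gauss_iso (G H : gauss_diagram) : bool :=
  gauss_iso_subdiagram G [set: arrow H].

Definition pairing (X : arrow_diagram) (G : gauss_diagram) : rat :=
  \sum_(S : {set arrow G} | iso_subdiagram X S) \prod_(a in S) sign a.

(* Formal rational linear combinations of arrow diagrams. *)
Definition pairing_lin (L : seq (rat * arrow_diagram)) (G : gauss_diagram) : rat :=
  \sum_(cX <- L) cX.1 * pairing cX.2 G.

(* The diagram with the word [w m] on the circle numbered [s m]. *)
Definition place (T : eqType) (w : 'I_3 -> seq T) (s : 'S_3) (c : 'I_3) : seq T :=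
  w (s^-1 c)%g.

Lemma place_count (T : eqType) (w : 'I_3 -> seq T) (s : 'S_3) (p : T) :
  (\sum_(c < 3) count_mem p (place w s c) = \sum_(m < 3) count_mem p (w m))%N.
Proof.
rewrite (reindex_inj (@perm_inj _ s)) /=.
by apply: eq_bigr => m _; rewrite /place permK.
Qed.

Definition words3 (T : eqType) (wi wj wk : seq T) (m : 'I_3) : seq T :=
  nth [::] [:: wi; wj; wk] m.

Definition tail_of (T : Type) (a : T) : T * bool := (a, true).
Definition head_of (T : Type) (a : T) : T * bool := (a, false).

(* The two-arrow diagrams, with (i, j, k) = (s 0, s 1, s 2).  The two arrows  *)
(* are [false] and [true]: the first one joins circles i and j, the second    *)
(* one joins circles j and k.                                                 *)
Definition Bword := words3 [:: tail_of false]
                           [:: head_of false; tail_of true]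
                           [:: head_of true].
Definition Cword := words3 [:: head_of false]
                           [:: tail_of false; head_of true]
                           [:: tail_of true].
Definition Aword := words3 [:: tail_of false]
                           [:: head_of false; head_of true]
                           [:: tail_of true].
Definition Dword := words3 [:: head_of false]
                           [:: tail_of false; tail_of true]
                           [:: head_of true].

Fact BwordP s p : (\sum_(c < 3) count_mem p (place Bword s c) = 1)%N.
Proof. by rewrite place_count !big_ord_recl big_ord0; case: p => -[] []. Qed.
Fact CwordP s p : (\sum_(c < 3) count_mem p (place Cword s c) = 1)%N.
Proof. by rewrite place_count !big_ord_recl big_ord0; case: p => -[] []. Qed.
Fact AwordP s p : (\sum_(c < 3) count_mem p (place Aword s c) = 1)%N.
Proof. by rewrite place_count !big_ord_recl big_ord0; case: p => -[] []. Qed.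
Fact DwordP s p : (\sum_(c < 3) count_mem p (place Dword s c) = 1)%N.
Proof. by rewrite place_count !big_ord_recl big_ord0; case: p => -[] []. Qed.

Definition Bdiag (s : 'S_3) : arrow_diagram := ArrowDiagram (BwordP s).
Definition Cdiag (s : 'S_3) : arrow_diagram := ArrowDiagram (CwordP s).
Definition Adiag (s : 'S_3) : arrow_diagram := ArrowDiagram (AwordP s).
Definition Ddiag (s : 'S_3) : arrow_diagram := ArrowDiagram (DwordP s).

Definition combination (s : 'S_3) : seq (rat * arrow_diagram) :=
  [:: (2, Bdiag s); (2, Cdiag s); (1, Adiag s); (1, Ddiag s)].

Definition P_even (G : gauss_diagram) : rat :=
  6^-1 * \sum_(s : 'S_3 | ~~ odd_perm s) pairing_lin (combination s) G.
Definition P_odd (G : gauss_diagram) : rat :=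
  6^-1 * \sum_(s : 'S_3 | odd_perm s) pairing_lin (combination s) G.

Definition mu (G : gauss_diagram) : rat := P_even G - P_odd G.
Definition mu_hat (G : gauss_diagram) : rat := P_even G + P_odd G.

(* Link diagrams.  An oriented link diagram on the 2-sphere is a combinatorial *)
(* map: its vertices are the crossings, its half-edges are the pairs [(p, d)]  *)
(* with [p] a passage of the link through a crossing ([(x, true)] the          *)
(* overpass, [(x, false)] the underpass) and [d = true] for the half-edge      *)
(* leaving the crossing, [d = false] for the one arriving at it.  Sign and     *)
(* orientations fix the counterclockwise order of half-edges at a crossing:    *)
(*   over-out, under-out, over-in, under-in   at a positive crossing,          *)
(*   over-out, under-in, over-in, under-out   at a negative one.               *)
(* Hence this map is recorded by the signed arrows, and a Gauss diagram comes  *)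
(* from a link diagram in the sphere iff every connected component of its map  *)
(* has Euler characteristic 2.  A circle without crossings is not seen by the  *)
(* map, and imposes no condition.                                              *)

Section Planarity.
Variable G : gauss_diagram.

Definition passage : finType := (arrow G * bool)%type.
Definition half_edge : finType := (passage * bool)%type.

Definition circle_of (p : passage) : 'I_3 :=
  odflt ord0 [pick c | p \in circle G c].

(* [next] and [prev] are cyclic: edges may contain the base point. *)
Definition opposite (h : half_edge) : half_edge :=
  let w := circle G (circle_of h.1) in
  if h.2 then (next w h.1, false) else (prev w h.1, true).

Definition rotate_ccw (h : half_edge) : half_edge :=
  let: ((x, over), out) := h in
  ((x, ~~ over), out (+) over (+) positive x).

Definition face_step (h : half_edge) : half_edge := rotate_ccw (opposite h).

Definition nb_faces : nat := fcard face_step [pred h : half_edge | true].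

Definition share_circle : rel (arrow G) := fun x y =>
  [exists c, exists b, exists b', ((x, b) \in circle G c) && ((y, b') \in circle G c)].

Definition nb_components : nat := n_comp share_circle [pred x : arrow G | true].

(* V - E + F = 2 * nb_components with V = #|arrow G| and E = 2 V. *)
Definition planar : bool :=
  (#|arrow G| + nb_faces == 2 * #|arrow G| + 2 * nb_components)%N.

End Planarity.

Record link_diagram := LinkDiagram {
  gauss :> gauss_diagram;
  gauss_planar : planar gauss }.

(* Replace every arrow end [p] by [tau p], and the signs by [pos]. *)
Fact permute_endsP (G : gauss_diagram) (tau : {perm arrow G * bool}) p :
  (\sum_(c < 3) count_mem p (map tau (circle G c)) = 1)%N.
Proof.
apply: (etrans _ (circleP (tau^-1 p)%g)); apply: eq_bigr => c _.
rewrite count_map; apply: eq_count => q /=.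
by apply/eqP/eqP => [<-|->]; rewrite ?permK ?permKV.
Qed.

Definition permute_ends (G : gauss_diagram) (tau : {perm arrow G * bool})
    (pos : pred (arrow G)) : gauss_diagram :=
  @GaussDiagram (ArrowDiagram (permute_endsP tau)) pos.

(* [q] immediately follows [p] on a circle, and the arc from [p] to [q] does  *)
(* not contain the base point.                                                *)
Definition consecutive (G : gauss_diagram) (p q : arrow G * bool) : bool :=
  [exists c, infix [:: p; q] (circle G c)].

Definition consecutive_dir (G : gauss_diagram) (e : bool) (p q : arrow G * bool) :=
  if e then consecutive p q else consecutive q p.

(* The moves take place in a disc disjoint from the base points. *)

(* First Reidemeister move: the arc of [H] from the crossing [a] to itself    *)
(* bounds a monogon; [G] is [H] without this kink.                            *)
Definition reidemeister1 (H G : gauss_diagram) : Prop :=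
  exists (a : arrow H) (b : bool),
    consecutive (a, b) (a, ~~ b) /\ gauss_iso_subdiagram G (~: [set a]).

(* Second move: in [H], one strand passes over another strand twice in a row; *)
(* the over-arc and the under-arc bound a bigon iff the signs are opposite.   *)
Definition reidemeister2 (H G : gauss_diagram) : Prop :=
  exists a b : arrow H,
    [/\ positive a != positive b,
        consecutive (tail_of a) (tail_of b),
        consecutive (head_of a) (head_of b) || consecutive (head_of b) (head_of a)
      & gauss_iso_subdiagram G (~: [set a; b])].

(* Third move: [p] is the crossing of the top strand over the middle one, [q] *)
(* of the top one over the bottom one, and [r] of the middle one over the     *)
(* bottom one.  The three arcs between them bound a triangle iff, writing     *)
(* [eT = true] if [p] precedes [q] on the top strand, [eM = true] if [p]      *)
(* precedes [r] on the middle one, [eB = true] if [q] precedes [r] on the     *)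
(* bottom one, the signs of [p], [q], [r] are, in multiplicative notation,    *)
(* [eta eT eM], [eta eT eB], [eta eM eB] for a common sign [eta], which is 1  *)
(* or -1 according as [p], [q], [r] lie counterclockwise or clockwise on the  *)
(* boundary of the triangle.  The move exchanges the two arrow ends on each   *)
(* of the three strands.                                                      *)
Definition reidemeister3 (G H : gauss_diagram) : Prop :=
  exists (p q r : arrow G) (eT eM eB : bool),
    [/\ uniq [:: p; q; r],
        [/\ consecutive_dir eT (tail_of p) (tail_of q),
            consecutive_dir eM (head_of p) (tail_of r)
          & consecutive_dir eB (head_of q) (head_of r)],
        exists eta : bool,
          [/\ positive p = eta (+) eT (+) eM,
              positive q = eta (+) eT (+) eB
            & positive r = eta (+) eM (+) eB]
      & gauss_iso
          (permute_ends
             (tperm (tail_of p) (tail_of q) * tperm (head_of p) (tail_of r)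
              * tperm (head_of q) (head_of r))%g
             (@positive G))
          H].

(* Crossing change at a crossing of a component with itself. *)
Definition self_crossing_change (G H : gauss_diagram) : Prop :=
  exists a : arrow G,
    (exists c, (tail_of a \in circle G c) && (head_of a \in circle G c)) /\
    gauss_iso
      (permute_ends (tperm (tail_of a) (head_of a))
         (fun x => if x == a then ~~ positive x else positive x))
      H.

Definition based_move (D E : link_diagram) : Prop :=
  [\/ gauss_iso D E, reidemeister1 D E, reidemeister2 D E
    | reidemeister3 D E \/ self_crossing_change D E].

(* Link homotopy of links with fixed base points. *)
Definition based_link_homotopic : link_diagram -> link_diagram -> Prop :=
  clos_refl_sym_trans link_diagram based_move.

Fact rebaseP (G : gauss_diagram) (n : 'I_3 -> nat) p :
  (\sum_(c < 3) count_mem p (rot (n c) (circle G c)) = 1)%N.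
Proof.
apply: (etrans _ (circleP p)); apply: eq_bigr => c _.
by rewrite /rot count_cat addnC -count_cat cat_take_drop.
Qed.

(* Move the base point of circle [c] forward past [n c] arrow ends. *)
Definition rebase (G : gauss_diagram) (n : 'I_3 -> nat) : gauss_diagram :=
  @GaussDiagram (ArrowDiagram (rebaseP n)) (@positive G).

Definition base_point_change (D E : link_diagram) : Prop :=
  exists n : 'I_3 -> nat, gauss_iso (rebase D n) E.

(* Link homotopy of the underlying links without base points. *)
Definition link_homotopic : link_diagram -> link_diagram -> Prop :=
  clos_refl_sym_trans link_diagram
    (fun D E => based_move D E \/ base_point_change D E).

(* Main.v *)
(** Write a pair of arrows of one of the diagrams A, B, C, D as its pair (u, v)
of ends on the middle circle, in the order in which they are met there.  All
four diagrams then become one condition on (u, v), and the combination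
2B + 2C + A + D becomes a sum over pairs of ends in which a pair weighs 2 if
exactly one of u, v is a head, and 1 otherwise.

Pairs involving an arrow with both ends on one circle do not contribute, which
gives invariance under the first Reidemeister move and self-crossing changes; in
the second move, exchanging the two arrows reverses the sign of every term in
which they occur.  The third move is a product of three exchanges of adjacent
ends; each exchange replaces one diagram on the circles (a, c, b) by one on
(b, c, a).  Up to the common sign, the three contributions to the sum over the
permutations of a given parity are X - Y, 2(Y - X) and X - Y, where X and Y count
the permutations with the cyclic orders (T, M, B) and (M, T, B) of the circles of
the top, middle and bottom strands.

Adding the terms of (i, j, k) and (k, j, i) removes the condition on the order of
u and v, so that the sum over all permutations does not see the base points. *)

Require Import Defs.
From mathcomp Require Import all_boot all_order all_fingroup all_algebra.
From mathcomp Require Import ring.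
From Stdlib Require Import Relation_Operators.

Set Implicit Arguments.
Unset Strict Implicit.
Unset Printing Implicit Defensive.

Import GRing.Theory.
Local Open Scope ring_scope.

(** * Order of two letters in a duplicate-free word *)

Section Before.
Variable T : eqType.
Implicit Types (u v p q : T) (w : seq T).

Definition before w u v := subseq [:: u; v] w.

Lemma before_cons u v p w :
  before (p :: w) u v = if u == p then v \in w else before w u v.
Proof. by rewrite /before /=; case: eqP => //; rewrite sub1seq. Qed.

Lemma before_meml w u v : before w u v -> u \in w.
Proof. by move=> /mem_subseq; apply; rewrite !inE eqxx. Qed.

Lemma before_memr w u v : before w u v -> v \in w.
Proof. by move=> /mem_subseq; apply; rewrite !inE eqxx orbT. Qed.

Lemma before_total w u v : uniq w -> u != v ->
  (before w u v)%:R + (before w v u)%:R = ((u \in w) && (v \in w))%:R :> rat.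
Proof.
elim: w => [|p w IHw] /=; first by rewrite addr0.
case/andP=> pw uw uv; rewrite !before_cons !inE.
have [up|up] := eqVneq u p; have [vp|vp] := eqVneq v p; subst => //=.
- by rewrite eqxx in uv.
- rewrite (negPf (contra (@before_memr _ _ _) pw)) addr0.
  by case: (v \in w).
- rewrite (negPf (contra (@before_memr _ _ _) pw)) add0r andbT.
  by case: (u \in w).
- exact: IHw.
Qed.

(** Only the mutual order of [p] and [q] changes. Rational indicators are used so that gain and loss
    can be summed. *)
Lemma before_swap w1 w2 p q u v : uniq (w1 ++ [:: p, q & w2]) ->
  (before (w1 ++ [:: q, p & w2]) u v)%:R =
  (before (w1 ++ [:: p, q & w2]) u v)%:R
    + ((u == q) && (v == p))%:R - ((u == p) && (v == q))%:R :> rat.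
Proof.
elim: w1 => [|a w1 IHw] /=.
  rewrite !before_cons !inE negb_or => /andP [/andP [pq pw] /andP [qw _]].
  have [uq|uq] := eqVneq u q; have [up|up] := eqVneq u p; subst => //=.
  - by rewrite eqxx in pq.
  - have [->|_] := eqVneq v p; last by rewrite addr0 subr0.
    by rewrite (negPf pw) add0r subr0.
  - have [->|_] := eqVneq v q; last by rewrite addr0 subr0.
    by rewrite (negPf qw) addr0 subrr.
  - by rewrite addr0 subr0.
case/andP; rewrite !before_cons !mem_cat !inE !negb_or => /and4P [_ ap aq _] uw.
have [->|_] := eqVneq u a; last exact: IHw.
by rewrite (negPf ap) (negPf aq) /= addr0 subr0 (orbCA (v == q)).
Qed.

Lemma before_nextl w1 w2 p q v : uniq (w1 ++ [:: p, q & w2]) ->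
  v != p -> v != q ->
  before (w1 ++ [:: p, q & w2]) p v = before (w1 ++ [:: p, q & w2]) q v.
Proof.
elim: w1 => [|a w1 IHw] /=.
  rewrite !before_cons !inE !eqxx negb_or => /andP [/andP [pq _] _] _ /negPf ->.
  by rewrite eq_sym (negPf pq).
case/andP; rewrite !before_cons !mem_cat !inE !negb_or => /and4P [_ ap aq _].
by rewrite ![_ == a]eq_sym (negPf ap) (negPf aq); apply: IHw.
Qed.

Lemma before_nextr w1 w2 p q v : uniq (w1 ++ [:: p, q & w2]) ->
  v != p -> v != q ->
  before (w1 ++ [:: p, q & w2]) v p = before (w1 ++ [:: p, q & w2]) v q.
Proof.
elim: w1 => [|a w1 IHw] /=.
  rewrite !before_cons !inE negb_or => /and3P [/andP [_ pw] qw _] vp vq.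
  rewrite (negPf vp) (negPf vq).
  have np: before w2 v p = false by apply: contraNF pw => /before_memr.
  by rewrite np; apply/esym/(contraNF _ qw) => /before_memr.
case/andP; rewrite !before_cons !mem_cat !inE !negb_or => /and4P [_ ap aq _] uw.
by rewrite !eqxx !orbT; have [|_] := eqVneq v a => //; apply: IHw.
Qed.

End Before.

Lemma before_map (T1 T2 : eqType) (f : T1 -> T2) w u v :
  injective f -> before (map f w) (f u) (f v) = before w u v.
Proof.
move=> fI; elim: w => //= a w IHw.
by rewrite !before_cons inj_eq // IHw mem_map.
Qed.

Lemma before_filter (T : eqType) (P : pred T) w u v :
  P u -> P v -> before (filter P w) u v = before w u v.
Proof. by move=> Pu Pv; rewrite /before subseq_filter /= Pu Pv. Qed.

Lemma uniq_map_inj (T1 T2 : eqType) (f : T1 -> T2) (w : seq T1) :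
  uniq (map f w) -> {in w &, injective f}.
Proof.
elim: w => //= a w IHw /andP [aw /IHw wI] x y.
rewrite !inE => /predU1P [->|xw] /predU1P [->|yw] // fE; last exact: wI.
  by rewrite fE map_f in aw.
by rewrite -fE map_f in aw.
Qed.

(** * Arrow ends and the circles that carry them *)

Section Circles.
Variable X : arrow_diagram.
Implicit Types (c d : 'I_3) (p q u v : arrow X * bool).

Lemma count_circle_le c p : (count_mem p (circle X c) <= 1)%N.
Proof. by rewrite -(circleP p) (bigD1 c) //= leq_addr. Qed.

Lemma circle_uniq c : uniq (circle X c).
Proof.
apply: count_mem_uniq => p; have := count_circle_le c p.
by rewrite -has_pred1 has_count; case: count => [|[]].
Qed.

Lemma circle_mem p : exists c, p \in circle X c.
Proof.
apply/existsP; apply: contraT; rewrite negb_exists => /forallP np.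
have := circleP p; rewrite big1 // => c _.
by apply/count_memPn.
Qed.

Lemma circle_inj p c d : p \in circle X c -> p \in circle X d -> c = d.
Proof.
move=> pc pd; apply/eqP; apply: contraT => cd.
have := circleP p; rewrite (bigD1 c) //= (bigD1 d) 1?eq_sym //=.
move: pc pd; rewrite -!has_pred1 !has_count.
by case: (count _ _) => // m _; case: (count _ _) => // n _; rewrite !addSn addnS.
Qed.

Lemma mem_circle p c d : p \in circle X c -> (p \in circle X d) = (d == c).
Proof.
by move=> pc; apply/idP/eqP => [/circle_inj/(_ pc)|->].
Qed.

End Circles.

(** * Pairings rewritten as sums over pairs of ends *)

(** Each end occurs exactly once over all circles. Hence two arrows with the same image would have
    their tails on one circle and produce a repeated letter there; and every end of an arrow in the
    image is itself the image of an end, so the filter keeps nothing else. *)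
Lemma embedding_subseq (X Y : arrow_diagram) (f : {ffun arrow X -> arrow Y}) :
  is_embedding (f @: [set: arrow X]) f
  = [forall c, subseq [seq (f p.1, p.2) | p <- circle X c] (circle Y c)].
Proof.
apply/idP/forallP => [/and3P [_ _ /forallP fP] c|fP].
  by rewrite (eqP (fP c)) filter_subseq.
have f_mem p c : p \in circle X c -> (f p.1, p.2) \in circle Y c.
  by move=> pc; apply: (mem_subseq (fP c)); apply/mapP; exists p.
rewrite /is_embedding eqxx /=; apply/andP; split.
  apply/injectiveP => a b fab.
  have [c ac] := circle_mem (a, true); have [d bd] := circle_mem (b, true).
  have cd : d = c.
    by have := f_mem _ _ bd; rewrite /= -fab => /circle_inj /(_ (f_mem _ _ ac)).
  rewrite cd in bd; have := subseq_uniq (fP c) (circle_uniq Y c).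
  move/uniq_map_inj => /(_ _ _ ac bd); rewrite /= fab => /(_ erefl).
  by case.
apply/forallP => c; apply/eqP.
rewrite {1}(subseq_uniqP (circle_uniq Y c) (fP c)).
apply: eq_in_filter => -[y b] yc /=.
apply/mapP/imsetP => [[p pc [-> _]]|[a _ ya]]; first by exists p.1.
exists (a, b) => /=; last by rewrite ya.
have [d ad] := circle_mem (a, b).
by have := f_mem _ _ ad; rewrite /= -ya => /circle_inj /(_ yc) <-.
Qed.

(** A based diagram has no nontrivial automorphism: the words read from the base points determine
    the embedding letter by letter. So each admissible [S] is the image of exactly one [f]. *)
Lemma pairing_embeddings (X : arrow_diagram) (G : gauss_diagram) :
  pairing X G =
  \sum_(f : {ffun arrow X -> arrow G}
         | [forall c, subseq [seq (f p.1, p.2) | p <- circle X c] (circle G c)])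
     \prod_a sign (f a).
Proof.
rewrite (partition_big (fun f : {ffun arrow X -> arrow G} => f @: [set: arrow X])
                       (fun S : {set arrow G} => iso_subdiagram X S)) /=; last first.
  by move=> f; rewrite -embedding_subseq => fE; apply/existsP; exists f.
apply: eq_bigr => S /existsP [f fS].
have [fI /eqP fim /forallP fP] := and3P fS.
rewrite (big_pred1 f) => [|g].
  rewrite -fim big_imset /=; last by move=> a b _ _; apply/injectiveP.
  by apply: eq_bigl => a; rewrite inE.
apply/andP/eqP => [[gP /eqP gS]|->]; last by rewrite -embedding_subseq fim.
move: gP; rewrite -embedding_subseq gS => /and3P [_ _ /forallP gP].
apply/ffunP => a; have [c ac] := circle_mem (a, true).
have /eqP : [seq (g p.1, p.2) | p <- circle X c] = [seq (f p.1, p.2) | p <- circle X c].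
  by rewrite (eqP (gP c)) (eqP (fP c)).
by move/eqP/eq_in_map => /(_ _ ac) [].
Qed.

Definition flip (A : Type) (p : A * bool) : A * bool := (p.1, ~~ p.2).

Definition coef (b c : bool) : rat := if b == c then 1 else 2.

(** With (i, j, k) the values of [s], the arrow of [u] joins i and j, that of [v] joins j and k, and
    [u], [v] are their ends on circle j. The factor [before] also forces both to lie there. *)
Definition term (G : gauss_diagram) (s : 'S_3) (u v : arrow G * bool) : rat :=
  coef u.2 v.2 * sign u.1 * sign v.1
  * ((flip u \in circle G (s ord0)) && (flip v \in circle G (s ord_max)))%:R
  * (before (circle G (s 1)) u v)%:R.
Arguments term : clear implicits.

Definition state_sum (G : gauss_diagram) (s : 'S_3) : rat :=
  \sum_u \sum_v term G s u v.

(** The kinds [(b, c)] of the two ends on the middle circle distinguish the four diagrams: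
    [(false, true)] is B, [(true, false)] is C, [(false, false)] is A and [(true, true)] is D. *)
Lemma pairing_two_arrows (G : gauss_diagram) (s : 'S_3) (b c : bool)
    (w := words3 [:: (false, ~~ b)] [:: (false, b); (true, c)] [:: (true, ~~ c)])
    (wP : forall p, (\sum_(d < 3) count_mem p (place w s d) = 1)%N) :
  coef b c * pairing (ArrowDiagram wP) G = \sum_x \sum_y term G s (x, b) (y, c).
Proof.
rewrite pairing_embeddings big_distrr /=.
(* A map from the two arrows is the pair of their images. *)
rewrite (reindex (fun p : arrow G * arrow G =>
                    [ffun e : bool => if e then p.2 else p.1])) /=; last first.
  exists (fun f : {ffun bool -> arrow G} => (f false, f true)) => [[x y] _|f _] /=.
    by rewrite !ffunE.
  by apply/ffunP => -[]; rewrite ffunE.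
rewrite big_mkcond pair_big; apply: eq_bigr => -[x y] _ /=.
rewrite /term /= /flip /=.
rewrite big_bool /= !ffunE.
set P := [forall _, _].
have -> : P = [&& (x, ~~ b) \in circle G (s ord0), (y, ~~ c) \in circle G (s ord_max)
                & before (circle G (s 1)) (x, b) (y, c)].
  apply/forallP/and3P => [xyP|[xP yP bP] d].
    have := xyP (s ord0); have := xyP (s 1); have := xyP (s ord_max).
    by rewrite /place !permK /w /words3 /= !ffunE !sub1seq /before => -> -> ->.
  (* Every circle is [s m] for some [m], which leaves one condition for each of the three words. *)
  rewrite -(permKV s d); move: ((s^-1)%g d) => m; rewrite /place permK /w /words3.
  case: m => -[|[|[|//]]] m3 /=; rewrite ?ffunE ?sub1seq.
  - by rewrite (_ : Ordinal m3 = ord0) //; apply: val_inj.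
  - by rewrite (_ : Ordinal m3 = 1) //; apply: val_inj.
  - by rewrite (_ : Ordinal m3 = ord_max) //; apply: val_inj.
by rewrite andbA; set m := (_ \in _) && (_ \in _); case: m; case: before => /=; ring.
Qed.

Lemma pairing_combination (G : gauss_diagram) (s : 'S_3) :
  pairing_lin (combination s) G = state_sum G s.
Proof.
rewrite /pairing_lin /combination !big_cons big_nil /=.
have -> : 2 * pairing (Bdiag s) G = \sum_x \sum_y term G s (x, false) (y, true).
  exact: (pairing_two_arrows G (b := false) (c := true) (BwordP s)).
have -> : 2 * pairing (Cdiag s) G = \sum_x \sum_y term G s (x, true) (y, false).
  exact: (pairing_two_arrows G (b := true) (c := false) (CwordP s)).
have -> : 1 * pairing (Adiag s) G = \sum_x \sum_y term G s (x, false) (y, false).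
  exact: (pairing_two_arrows G (b := false) (c := false) (AwordP s)).
have -> : 1 * pairing (Ddiag s) G = \sum_x \sum_y term G s (x, true) (y, true).
  exact: (pairing_two_arrows G (b := true) (c := true) (DwordP s)).
rewrite /state_sum.
transitivity (\sum_x \sum_y \sum_b \sum_c term G s (x, b) (y, c)).
  rewrite addr0 -!big_split /=; apply: eq_bigr => x _.
  rewrite -!big_split; apply: eq_bigr => y _ /=.
  rewrite !big_bool /=; ring.
have ends (K : arrow G * bool -> rat) : \sum_u K u = \sum_x \sum_b K (x, b).
  by rewrite pair_bigA; apply: eq_bigr => -[].
rewrite ends; apply: eq_bigr => x _; rewrite exchange_big; apply: eq_bigr => b _ /=.
by rewrite ends.
Qed.

Lemma P_evenE G : P_even G = 6^-1 * \sum_(s : 'S_3 | ~~ odd_perm s) state_sum G s.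
Proof. by congr (_ * _); apply: eq_bigr => s _; apply: pairing_combination. Qed.

Lemma P_oddE G : P_odd G = 6^-1 * \sum_(s : 'S_3 | odd_perm s) state_sum G s.
Proof. by congr (_ * _); apply: eq_bigr => s _; apply: pairing_combination. Qed.

Lemma term_neq0 G s u v : term G s u v != 0 ->
  [/\ flip u \in circle G (s ord0), u \in circle G (s 1),
      v \in circle G (s 1) & flip v \in circle G (s ord_max)].
Proof.
rewrite /term; case: andP => [[-> ->]|_]; last by rewrite mulr0 mul0r eqxx.
case: (boolP (before _ _ _)) => [bP _|_]; last by rewrite mulr0 eqxx.
by split; [|exact: before_meml bP|exact: before_memr bP|].
Qed.

(** * Subdiagrams, and cancellation of the terms outside them *)

Lemma state_sum_sub (G H : gauss_diagram) (S : {set arrow H}) s :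
  gauss_iso_subdiagram G S ->
  state_sum G s = \sum_(u | u.1 \in S) \sum_(v | v.1 \in S) term H s u v.
Proof.
case/existsP => f /andP [/and3P [/injectiveP fI /eqP fS /forallP fP] /forallP fpos].
pose F (p : arrow G * bool) := (f p.1, p.2).
have FI : injective F by move=> [x b] [y c] [/fI -> ->].
have FS : F @: setT =i [pred u | u.1 \in S].
  move=> [y b]; rewrite !inE -fS /=; apply/imsetP/imsetP => [[[x c] _ [-> _]]|[x _ ->]].
    by exists x.
  by exists (x, b).
have memF p c : (F p \in circle H c) = (p \in circle G c).
  rewrite -(mem_map FI (circle G c)) (eqP (fP c)) mem_filter.
  by rewrite /= -fS imset_f.
have beforeF u v c : before (circle H c) (F u) (F v) = before (circle G c) u v.
  by rewrite -(before_map _ _ _ FI) (eqP (fP c)) before_filter //= -fS imset_f.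
have termF u v : term G s u v = term H s (F u) (F v).
  have flipF p : flip (F p) = F (flip p) by [].
  by rewrite /term beforeF !flipF !memF /sign !(eqP (fpos _)).
have sumF K : \sum_(u | u.1 \in S) K u = \sum_u K (F u) :> rat.
  rewrite -(eq_bigl _ _ FS) big_imset /=; last by move=> ? ? _ _; apply: FI.
  by apply: eq_bigl => u; rewrite inE.
rewrite sumF; apply: eq_bigr => u _; rewrite sumF.
by apply: eq_bigr => v _; apply: termF.
Qed.

Lemma state_sum_iso (G H : gauss_diagram) s :
  gauss_iso G H -> state_sum G s = state_sum H s.
Proof.
move=> /state_sum_sub ->; apply: eq_big => [u|u _]; first by rewrite inE.
by apply: eq_bigl => v; rewrite inE.
Qed.

Lemma sum_antisym (I : finType) (P : pred I) (F : I -> rat) (h : I -> I) :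
  injective h -> (forall i, P (h i) = P i) ->
  (forall i, P i -> F (h i) = - F i) -> \sum_(i | P i) F i = 0.
Proof.
move=> hI hP hF; set S := bigop _ _ _.
suff : S *+ 2 == 0 by rewrite Num.Theory.mulrn_eq0 => /eqP.
rewrite mulr2n /S.
rewrite {1}(reindex_inj hI) (eq_bigl _ _ hP) /= (eq_bigr _ hF) sumrN.
by rewrite addNr.
Qed.

(** Meant for moves that delete the arrows outside [S]: [h] reverses the sign of every term
    involving a deleted arrow. The terms with [u] outside [S] cancel first, then those with [u]
    inside and [v] outside; what is left is the state sum of [G]. *)
Lemma state_sum_cancel (G H : gauss_diagram) (S : {set arrow H})
    (h : arrow H * bool -> arrow H * bool) s :
  injective h -> (forall u, ((h u).1 \in S) = (u.1 \in S)) ->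
  (forall u v, u.1 \notin S -> term H s (h u) v = - term H s u v) ->
  (forall u v, v.1 \notin S -> term H s u (h v) = - term H s u v) ->
  gauss_iso_subdiagram G S -> state_sum G s = state_sum H s.
Proof.
move=> hI hS antil antir /state_sum_sub ->.
rewrite /state_sum [RHS](bigID (fun u => u.1 \in S)) /=.
rewrite [X in _ = _ + X](sum_antisym hI) ?addr0 => [|u|u uS]; last first.
- by rewrite -sumrN; apply: eq_bigr => v _; apply: antil.
- by rewrite hS.
apply: eq_bigr => u _; rewrite [RHS](bigID (fun v => v.1 \in S)) /=.
rewrite [X in _ = _ + X](sum_antisym hI) ?addr0 // => [v|v vS]; last exact: antir.
by rewrite hS.
Qed.

(** * First and second Reidemeister moves *)

Definition self_arrow (G : gauss_diagram) (a : arrow G) : Prop :=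
  exists c, (tail_of a \in circle G c) && (head_of a \in circle G c).

Lemma self_arrow_end (G : gauss_diagram) (a : arrow G) (b b' : bool) c :
  self_arrow a -> ((a, b) \in circle G c) = ((a, b') \in circle G c).
Proof.
case=> d /andP [ta ha].
by case: b; case: b'; rewrite ?(mem_circle _ ta) ?(mem_circle _ ha).
Qed.

Lemma perm_ord_neq (s : 'S_3) (i j : 'I_3) : i != j -> s i <> s j.
Proof. by move/eqP=> ij /perm_inj. Qed.

Lemma term_selfl G s u v : self_arrow u.1 -> term G s u v = 0.
Proof.
move=> uself; apply/eqP; apply: contraT => /term_neq0 [].
case: u uself => a b /= aself; rewrite (self_arrow_end _ b _ aself).
by move=> /circle_inj a0 /a0 /perm_ord_neq; case.
Qed.

Lemma term_selfr G s u v : self_arrow v.1 -> term G s u v = 0.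
Proof.
move=> vself; apply/eqP; apply: contraT => /term_neq0 [_ _].
case: v vself => a b /= aself; rewrite (self_arrow_end _ (~~ b) _ aself).
by move=> /circle_inj a0 /a0 /perm_ord_neq; case.
Qed.

Lemma consecutive_split (G : gauss_diagram) (p q : arrow G * bool) :
  consecutive p q -> exists c w1 w2, circle G c = w1 ++ [:: p, q & w2].
Proof. by case/existsP => c /infixP [w1 [w2 E]]; exists c, w1, w2. Qed.

Lemma consecutive_mem (G : gauss_diagram) (p q : arrow G * bool) c :
  consecutive p q -> (p \in circle G c) = (q \in circle G c).
Proof.
case/consecutive_split => d [w1 [w2 E]].
have pd : p \in circle G d by rewrite E mem_cat !inE eqxx orbT.
have qd : q \in circle G d by rewrite E mem_cat !inE eqxx !orbT.
by rewrite (mem_circle _ pd) (mem_circle _ qd).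
Qed.

(** No third end separates [p] from [q] on their circle; on the other circles all four relations are
    false. *)
Lemma consecutive_before (G : gauss_diagram) (p q v : arrow G * bool) c :
  consecutive p q -> v != p -> v != q ->
  before (circle G c) p v = before (circle G c) q v /\
  before (circle G c) v p = before (circle G c) v q.
Proof.
move=> pq vp vq; have [d [w1 [w2 E]]] := consecutive_split pq.
have [pc|pc] := boolP (p \in circle G c).
  have <- : d = c by apply: circle_inj pc; rewrite E mem_cat !inE eqxx orbT.
  have := circle_uniq G d; rewrite E => uw.
  by rewrite (before_nextl uw vp vq) (before_nextr uw vp vq).
have qc : q \notin circle G c by rewrite -(consecutive_mem c pq).
have out x : x \notin circle G c ->
    before (circle G c) x v = false /\ before (circle G c) v x = false.
  by move=> xc; split; apply: contraNF xc; [apply: before_meml|apply: before_memr].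
by have [-> ->] := out p pc; have [-> ->] := out q qc.
Qed.

Lemma state_sum_R1 (H G : gauss_diagram) s :
  reidemeister1 H G -> state_sum H s = state_sum G s.
Proof.
case=> a [b [ab GH]]; apply/esym.
have aself : self_arrow a.
  have [c ac] := circle_mem (a, b); have := ac; rewrite (consecutive_mem c ab).
  by move=> anc; exists c; move: ac anc {ab}; case: b => /= -> ->.
(* The identity suffices: the deleted terms are zero, hence equal to their opposites. *)
apply: (state_sum_cancel (h := id) _ _ _ _ GH) => // u v.
  by rewrite !inE negbK => /eqP ua; rewrite term_selfl ?ua ?oppr0.
by rewrite !inE negbK => /eqP va; rewrite term_selfr ?va ?oppr0.
Qed.

Lemma state_sum_R2 (H G : gauss_diagram) s :
  reidemeister2 H G -> state_sum H s = state_sum G s.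
Proof.
case=> a [b [ab_sign tails heads GH]]; apply/esym.
have near : forall e, consecutive (a, e) (b, e) || consecutive (b, e) (a, e).
  by case; rewrite ?tails.
have par e c : ((a, e) \in circle H c) = ((b, e) \in circle H c).
  by have /orP [/(consecutive_mem c)|/(consecutive_mem c) <-] := near e.
have par2 x y e c : x \notin ~: [set a; b] -> y \notin ~: [set a; b] ->
    ((x, e) \in circle H c) = ((y, e) \in circle H c).
  by rewrite !inE !negbK => /orP [] /eqP -> /orP [] /eqP ->.
(* Corresponding ends of [a] and [b] share a circle, so a nonzero term using only these arrows would
   identify two of the three circles of [s]. *)
have term0 u v : u.1 \notin ~: [set a; b] -> v.1 \notin ~: [set a; b] ->
    term H s u v = 0.
  case: u v => x e [y e'] /= xS yS; apply/eqP; apply: contraT => /term_neq0 [].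
  rewrite /flip /= !(par2 x y) //.
  have [<-|ee'] := eqVneq e e'.
    by move=> /circle_inj y0 _ _ /y0 /perm_ord_neq; case.
  have -> : e' = ~~ e by case: e e' ee' => -[].
  by move=> /circle_inj y0 _ /y0 /perm_ord_neq; case.
(* The exchange of the two arrows, whose signs are opposite. *)
pose h (u : arrow H * bool) := (tperm a b u.1, u.2).
have sgn_ab : sign a = - sign b.
  by rewrite /sign; move: ab_sign; do 2!case: positive => //=; rewrite opprK.
have hS u : ((h u).1 \in ~: [set a; b]) = (u.1 \in ~: [set a; b]).
  by rewrite !inE /=; case: tpermP => [->|->|//]; rewrite !eqxx ?orbT.
have hsgn u : u.1 \notin ~: [set a; b] -> sign (h u).1 = - sign u.1.
  rewrite !inE negbK /h /= => /orP [] /eqP ->; rewrite ?tpermL ?tpermR sgn_ab //.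
  by rewrite opprK.
have hmem u c : (h u \in circle H c) = (u \in circle H c).
  case: u => x e; rewrite /h /=; case: tpermP => [->|->|//]; first by rewrite par.
  by rewrite par.
have hflip u : flip (h u) = h (flip u) by [].
(* Adjacent ends of [a] and [b] are in the same position relative to any end of another arrow. *)
have hbefore u v c : v.1 \in ~: [set a; b] ->
    before (circle H c) (h u) v = before (circle H c) u v /\
    before (circle H c) v (h u) = before (circle H c) v u.
  rewrite !inE negb_or => /andP [va vb].
  have nv x : v.1 != x -> forall e, v != (x, e).
    by move=> vx e; apply: contraNneq vx => ->.
  have key e : before (circle H c) (a, e) v = before (circle H c) (b, e) v /\
               before (circle H c) v (a, e) = before (circle H c) v (b, e).
    have [ab|ba] := orP (near e).
      exact: (consecutive_before _ ab (nv a va e) (nv b vb e)).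
    by have [-> ->] := consecutive_before c ba (nv b vb e) (nv a va e).
  case: u => x e; rewrite /h /=; have [aE bE] := key e.
  by case: tpermP => [->|->|//]; rewrite ?aE ?bE.
have hI : injective h by move=> [x e] [y e'] [/perm_inj -> ->].
apply: (state_sum_cancel hI hS _ _ GH) => u v uS.
  have [vS|vS] := boolP (v.1 \in ~: [set a; b]); last first.
    by rewrite !term0 ?hS // oppr0.
  by rewrite /term (hbefore _ _ _ vS).1 hflip hmem hsgn //=; ring.
have [vS|vS] := boolP (u.1 \in ~: [set a; b]); last first.
  by rewrite !term0 ?hS // oppr0.
by rewrite /term (hbefore _ _ _ vS).2 hflip hmem hsgn //=; ring.
Qed.

(** * Exchange of two adjacent ends *)

Lemma mem_permute_ends (G : gauss_diagram) (tau : {perm arrow G * bool}) pos :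
  (forall p c, (tau p \in circle G c) = (p \in circle G c)) ->
  forall p c, (p \in circle (permute_ends tau pos) c) = (p \in circle G c).
Proof.
move=> tauG p c; rewrite -{1}(permKV tau p) /= mem_map; last exact: perm_inj.
by rewrite -tauG permKV.
Qed.

Lemma consecutive_tperm (G : gauss_diagram) (p q u : arrow G * bool) c :
  consecutive p q -> (tperm p q u \in circle G c) = (u \in circle G c).
Proof. by move=> /(consecutive_mem c) pq; case: tpermP => [->|->|//]; rewrite pq. Qed.

Lemma before_tperm (G : gauss_diagram) (p q u v : arrow G * bool) c :
  consecutive p q ->
  (before (map (tperm p q) (circle G c)) u v)%:R =
  (before (circle G c) u v)%:R
  + (p \in circle G c)%:R
    * (((u == q) && (v == p))%:R - ((u == p) && (v == q))%:R) :> rat.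
Proof.
move=> pq; have [d [w1 [w2 E]]] := consecutive_split pq.
have [pc|pc] := boolP (p \in circle G c).
  have <- : d = c by apply: circle_inj pc; rewrite E mem_cat !inE eqxx orbT.
  have uw := circle_uniq G d; rewrite E in uw *.
  rewrite mul1r addrA -before_swap // map_cat /= tpermL tpermR.
  move: uw; rewrite cat_uniq /= !inE !negb_or.
  case/and5P => _ /and3P [pw1 qw1 _] /andP [_ pw2] qw2 _.
  by rewrite !map_id_in // => x xw; rewrite tpermD //;
     [apply: contraNneq pw2|apply: contraNneq qw2|apply: contraNneq pw1
     |apply: contraNneq qw1] => ->.
have qc : q \notin circle G c by rewrite -(consecutive_mem c pq).
rewrite mul0r addr0 map_id_in // => x xc.
by rewrite tpermD //; [apply: contraNneq pc|apply: contraNneq qc] => ->.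
Qed.

Definition triple (s : 'S_3) (a b c : 'I_3) : bool :=
  [&& s ord0 == a, s 1 == b & s ord_max == c].

Lemma sum_delta (I J : finType) (K : I -> J -> rat) i0 j0 :
  \sum_i \sum_j K i j * ((i == i0) && (j == j0))%:R = K i0 j0.
Proof.
rewrite (bigD1 i0) //= (bigD1 j0) //= !eqxx mulr1.
rewrite big1 => [|j /negPf ->]; last by rewrite andbF mulr0.
rewrite big1 ?addr0 // => i /negPf ->.
by rewrite big1 // => j _; rewrite mulr0.
Qed.

(** The term of [(q, p)] is gained, which [s] sees when it is (b, c, a), and that of [(p, q)] is
    lost, seen when [s] is (a, c, b). If two of the circles coincide, both indicators vanish. *)
Lemma state_sum_swap (G : gauss_diagram) (p q : arrow G * bool) a b c s :
  consecutive p q -> p \in circle G c ->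
  flip p \in circle G a -> flip q \in circle G b ->
  state_sum (permute_ends (tperm p q) (@positive G)) s =
  state_sum G s + coef p.2 q.2 * sign p.1 * sign q.1
                  * ((triple s b c a)%:R - (triple s a c b)%:R).
Proof.
move=> pq pc pa qb.
have memG u d : (u \in circle (permute_ends (tperm p q) (@positive G)) d)
                = (u \in circle G d).
  by apply: mem_permute_ends => v e; apply: consecutive_tperm.
(* The term without its order condition, which is the only factor affected by the exchange. *)
pose K u v := coef u.2 v.2 * sign u.1 * sign v.1
  * ((flip u \in circle G (s ord0)) && (flip v \in circle G (s ord_max)))%:R
  * (p \in circle G (s 1))%:R.
transitivity (\sum_u \sum_v (term G s u v
    + (K u v * ((u == q) && (v == p))%:R - K u v * ((u == p) && (v == q))%:R))).
  apply: eq_bigr => u _; apply: eq_bigr => v _.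
  rewrite {1}/term !memG [before _ _ _]/(before (map _ _) u v) before_tperm //.
  by rewrite /term /K; ring.
under eq_bigr do rewrite big_split sumrB /=.
rewrite big_split sumrB !sum_delta /= /K.
rewrite !(mem_circle _ pa) !(mem_circle _ qb) !(mem_circle _ pc) /triple.
have -> : coef q.2 p.2 = coef p.2 q.2 by rewrite /coef eq_sym.
congr (_ + _); case: (s ord0 == a); case: (s ord0 == b); case: (s 1 == c);
  case: (s ord_max == a); case: (s ord_max == b) => /=; ring.
Qed.

(** * Third Reidemeister move and self-crossing changes, for one parity class *)

Section EvenInvariant.
Variable P : pred 'S_3.
(** Both the even and the odd permutations form such a class, so one argument serves [P_even] and
    [P_odd]. *)
Hypothesis even_P : forall z s : 'S_3, ~~ odd_perm z -> P (z * s)%g = P s.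

Definition class_sum (G : gauss_diagram) : rat := \sum_(s | P s) state_sum G s.
Definition nb_triple a b c : rat := \sum_(s | P s) (triple s a b c)%:R.

Lemma nb_triple_cycle a b c : nb_triple a b c = nb_triple c a b.
Proof.
(* The 3-cycle 0 -> 1 -> 2 -> 0, which is even. *)
pose z : 'S_3 := (tperm ord0 1%R * tperm ord0 ord_max)%g.
rewrite /nb_triple (reindex_inj (mulgI z)); apply: eq_big => s.
  by apply: even_P; rewrite odd_permM !odd_tperm.
rewrite /triple !permM (tpermD (x := ord0) (z := ord_max)) // tpermL tpermR.
by rewrite tpermL tpermR tpermD // => _; case: eqP; case: eqP; case: eqP.
Qed.

(** Reversing the direction exchanges [p] with [q] and [a] with [b], which only changes the sign of
    the correction. *)
Lemma class_sum_swap (G : gauss_diagram) e (p q : arrow G * bool) a b c :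
  consecutive_dir e p q -> p \in circle G c ->
  flip p \in circle G a -> flip q \in circle G b ->
  class_sum (permute_ends (tperm p q) (@positive G)) =
  class_sum G + (-1) ^+ (~~ e) * coef p.2 q.2 * sign p.1 * sign q.1
                * (nb_triple b c a - nb_triple a c b).
Proof.
rewrite /class_sum /nb_triple -sumrB mulr_sumr -big_split /=.
case: e => /= pq pc pa qb; apply: eq_bigr => s _.
  by rewrite (state_sum_swap s pq pc pa qb) expr0 mul1r.
have qc : q \in circle G c by rewrite (consecutive_mem c pq).
rewrite tpermC (state_sum_swap s pq qc qb pa).
have -> : coef q.2 p.2 = coef p.2 q.2 by rewrite /coef eq_sym.
rewrite expr1; ring.
Qed.

(** Decomposes the move into successive exchanges, each made in the diagram produced by the previous
    one. *)
Lemma class_sum_permute_ends3 (G : gauss_diagram) (t1 t2 t3 : {perm arrow G * bool})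
    (G1 := permute_ends t1 (@positive G))
    (G2 := permute_ends (G := G1) t2 (@positive G)) :
  class_sum (permute_ends (t1 * t2 * t3)%g (@positive G))
  = class_sum (permute_ends (G := G2) t3 (@positive G)).
Proof.
apply: eq_bigr => s _; apply: eq_bigr => u _; apply: eq_bigr => v _.
have E c : circle (permute_ends (t1 * t2 * t3)%g (@positive G)) c =
           circle (permute_ends (G := G2) t3 (@positive G)) c.
  by rewrite /= -!map_comp; apply: eq_map => w; rewrite /= !permM.
by rewrite /term !E.
Qed.

Lemma consecutive_dir_permute_ends (G : gauss_diagram) (t : {perm arrow G * bool})
    pos e (p q : arrow G * bool) :
  t p = p -> t q = q -> consecutive_dir e p q ->
  consecutive_dir (G := permute_ends t pos) e p q.
Proof.
have infix_map u v w : t u = u -> t v = v -> infix [:: u; v] w -> infix [:: u; v] (map t w).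
  move=> tu tv /infixP [w1 [w2 ->]]; apply/infixP; exists (map t w1), (map t w2).
  by rewrite !map_cat /= tu tv.
move=> tp tq; rewrite /consecutive_dir.
by case: e => /existsP [c cP]; apply/existsP; exists c; apply: infix_map.
Qed.

Lemma class_sum_R3 (G H : gauss_diagram) :
  reidemeister3 G H -> class_sum G = class_sum H.
Proof.
case=> p [q [r [eT [eM [eB [pqr [cT cM cB] [eta [sp sq sr]] GH]]]]]].
have <- : class_sum (permute_ends (tperm (tail_of p) (tail_of q) *
    tperm (head_of p) (tail_of r) * tperm (head_of q) (head_of r))%g (@positive G))
    = class_sum H.
  by apply: eq_bigr => s _; apply: state_sum_iso.
have [T pT] := circle_mem (tail_of p); have [M pM] := circle_mem (head_of p).
have [B qB] := circle_mem (head_of q).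
have dir_mem e u v c : consecutive_dir e u v -> u \in circle G c -> v \in circle G c.
  by case: e => /= /(consecutive_mem c) ->.
have qT := dir_mem _ _ _ _ cT pT; have rM := dir_mem _ _ _ _ cM pM.
have rB := dir_mem _ _ _ _ cB qB.
have dir_tperm e u v w c : consecutive_dir e u v ->
    (tperm u v w \in circle G c) = (w \in circle G c).
  by case: e => /= uv; [|rewrite tpermC]; apply: consecutive_tperm.
move: pqr; rewrite /= !inE negb_or andbT => /andP [/andP [pq pr] qr].
set t1 := tperm (tail_of p) _; set t2 := tperm (head_of p) _; set t3 := tperm _ _.
pose G1 := permute_ends t1 (@positive G).
pose G2 := permute_ends (G := G1) t2 (@positive G).
have mem1 u c : (u \in circle G1 c) = (u \in circle G c).
  by apply: mem_permute_ends => w d; apply: dir_tperm cT.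
have mem2 u c : (u \in circle G2 c) = (u \in circle G c).
  rewrite -mem1; apply: mem_permute_ends => w d.
  by rewrite !mem1; apply: dir_tperm cM.
have end_neq (x y : arrow G) b c : (x != y) || (b != c) -> (x, b) != (y, c).
  by rewrite xpair_eqE negb_and.
(* The six ends are distinct, so an exchange on one strand leaves the ends on the others
   adjacent. *)
have cM1 : consecutive_dir (G := G1) eM (head_of p) (tail_of r).
  by apply: consecutive_dir_permute_ends cM; apply: tpermD; apply: end_neq;
     rewrite ?pr ?qr ?orbT.
have cB2 : consecutive_dir (G := G2) eB (head_of q) (head_of r).
  by apply: consecutive_dir_permute_ends; last (apply: consecutive_dir_permute_ends cB);
     apply: tpermD; apply: end_neq; rewrite ?pq ?pr ?orbT.
rewrite class_sum_permute_ends3.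
rewrite (class_sum_swap (G := G2) (a := T) (b := M) (c := B) cB2) ?mem2 //.
rewrite (class_sum_swap (G := G1) (a := T) (b := B) (c := M) cM1) ?mem1 //.
rewrite (class_sum_swap (a := M) (b := B) (c := T) cT) //.
(* Cyclic rotation reduces the six counts to two, one for each cyclic order of the strands. *)
rewrite (nb_triple_cycle T M B) (nb_triple_cycle B T M).
rewrite (nb_triple_cycle M T B) (nb_triple_cycle B M T).
rewrite /sign /= sp sq sr /coef /=.
(* In each correction [eta] occurs squared, and direction times signs is the product of [eT], [eM],
   [eB]. The weights are 1 for two tails, 2 for a head and a tail, 1 for two heads, and the middle
   difference has the opposite sign. *)
by case: eta {sp sq sr}; case: eT {cT}; case: eM {cM cM1}; case: eB {cB cB2} => /=; ring.
Qed.

Lemma class_sum_self_crossing_change (G H : gauss_diagram) :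
  self_crossing_change G H -> class_sum G = class_sum H.
Proof.
case=> a [aself GH]; apply: eq_bigr => s _.
rewrite -(state_sum_iso s GH).
apply: eq_bigr => u _; apply: eq_bigr => v _.
set t := tperm _ _; set pos := fun _ => _.
pose K := permute_ends (G := G) t pos.
rewrite -[X in _ = X]/(term K s u v).
have memt p c : (t p \in circle G c) = (p \in circle G c).
  by rewrite /t; case: tpermP => [->|->|//]; apply: self_arrow_end.
have memK p c : (p \in circle K c) = (p \in circle G c).
  exact: mem_permute_ends.
have aselfK : self_arrow (G := K) a.
  by case: aself => c ac; exists c; rewrite !memK.
(* Terms involving [a] vanish in both diagrams; all other ends are fixed by [t] and keep their
   signs. *)
have [ua|ua] := eqVneq u.1 a.
  by rewrite !term_selfl ?ua.
have [va|va] := eqVneq v.1 a.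
  by rewrite !term_selfr ?va.
have tfix p : p.1 != a -> t p = p.
  by move=> pa; rewrite tpermD // eq_sym; apply: contraNneq pa => ->.
rewrite /term !memK -[in RHS](tfix u ua) -[in RHS](tfix v va).
rewrite before_map; last exact: perm_inj.
by rewrite !tfix // /sign /= /pos (negPf ua) (negPf va).
Qed.

Lemma class_sum_move (D E : link_diagram) :
  based_move D E -> class_sum D = class_sum E.
Proof.
case=> [DE|DE|DE|[DE|DE]].
- by apply: eq_bigr => s _; apply: state_sum_iso.
- by apply: eq_bigr => s _; apply: state_sum_R1.
- by apply: eq_bigr => s _; apply: state_sum_R2.
- exact: class_sum_R3.
- exact: class_sum_self_crossing_change.
Qed.

End EvenInvariant.

(** * Invariance of both parity sums, and independence of the base points *)

Lemma P_even_move (D E : link_diagram) : based_move D E -> P_even D = P_even E.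
Proof.
move=> DE; rewrite !P_evenE; congr (_ * _).
apply: (class_sum_move (P := fun s => ~~ odd_perm s)) => // z s zE.
by rewrite odd_permM (negPf zE).
Qed.

Lemma P_odd_move (D E : link_diagram) : based_move D E -> P_odd D = P_odd E.
Proof.
move=> DE; rewrite !P_oddE; congr (_ * _).
apply: (class_sum_move (P := fun s => odd_perm s)) => // z s zE.
by rewrite odd_permM (negPf zE).
Qed.

Lemma mu_hatE G : mu_hat G = 6^-1 * \sum_(s : 'S_3) state_sum G s.
Proof.
rewrite /mu_hat P_evenE P_oddE -mulrDr; congr (_ * _).
by rewrite [RHS](bigID (fun s : 'S_3 => odd_perm s)) addrC.
Qed.

(** The right-hand side involves only membership in circles, no order, which is what makes it
    insensitive to rotating the words. *)
Lemma double_state_sum G :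
  (\sum_(s : 'S_3) state_sum G s) *+ 2 =
  \sum_(s : 'S_3) \sum_u \sum_v coef u.2 v.2 * sign u.1 * sign v.1
    * ((flip u \in circle G (s ord0)) && (flip v \in circle G (s ord_max)))%:R
    * ((u \in circle G (s 1)) && (v \in circle G (s 1)))%:R.
Proof.
(* Exchanges i and k; together with the exchange of [u] and [v], this gives the same term with the
   opposite order. *)
pose z : 'S_3 := tperm ord0 ord_max.
rewrite mulr2n {2}(reindex_inj (mulgI z)) -big_split; apply: eq_bigr => s _ /=.
rewrite {2}/state_sum exchange_big -big_split; apply: eq_bigr => u _ /=.
rewrite -big_split; apply: eq_bigr => v _ /=.
rewrite /term !permM tpermL tpermR tpermD //.
have -> : coef v.2 u.2 = coef u.2 v.2 by rewrite /coef eq_sym.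
rewrite [(flip v \in _) && _]andbC.
have [/andP [u0 v2]|_] := boolP (_ && _); last by rewrite !mulr0 !mul0r addr0.
rewrite -before_total; first by ring.
  exact: circle_uniq.
(* The ends [u] and [v] differ, since their other ends lie on distinct circles. *)
apply: contraTneq v2 => <-; rewrite (mem_circle _ u0).
by apply/eqP; apply: perm_ord_neq.
Qed.

Lemma mu_hat_rebase (G : gauss_diagram) n : mu_hat (rebase G n) = mu_hat G.
Proof.
rewrite !mu_hatE; congr (_ * _); apply: (Num.Theory.pmulrnI (n := 2)) => //=.
rewrite !double_state_sum; apply: eq_bigr => s _.
by apply: eq_bigr => u _; apply: eq_bigr => v _; rewrite /= !mem_rot.
Qed.

Lemma mu_hat_base_point_change (D E : link_diagram) :
  base_point_change D E -> mu_hat D = mu_hat E.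
Proof.
case=> n DE; rewrite -(mu_hat_rebase D n) !mu_hatE; congr (_ * _).
by apply: eq_bigr => s _; apply: state_sum_iso.
Qed.

Lemma invariant_closure (A B : Type) (R : A -> A -> Prop) (f : A -> B) x y :
  (forall a b, R a b -> f a = f b) -> clos_refl_sym_trans A R x y -> f x = f y.
Proof. by move=> fR; elim=> // a b c _ -> _ ->. Qed.

Theorem corollary1 (t : rat) :
  (forall D E : link_diagram, based_link_homotopic D E ->
     (1 - t) * mu D + t * mu_hat D = (1 - t) * mu E + t * mu_hat E) /\
  (t = 1 ->
     (forall D E : link_diagram, base_point_change D E ->
        (1 - t) * mu D + t * mu_hat D = (1 - t) * mu E + t * mu_hat E) /\
     (forall D E : link_diagram, link_homotopic D E ->
        (1 - t) * mu D + t * mu_hat D = (1 - t) * mu E + t * mu_hat E)).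
Proof.
have mu_hat_move D E : based_move D E -> mu_hat D = mu_hat E.
  by move=> DE; rewrite /mu_hat (P_even_move DE) (P_odd_move DE).
split=> [D E|->].
  apply: (invariant_closure (f := fun D : link_diagram =>
                                (1 - t) * mu D + t * mu_hat D)) => {}D {}E DE.
  by rewrite (mu_hat_move _ _ DE) /mu (P_even_move DE) (P_odd_move DE).
(* At [t = 1] only [mu_hat] remains. *)
rewrite subrr; split=> D E DE; rewrite !mul0r !add0r !mul1r.
  exact: mu_hat_base_point_change.
apply: (invariant_closure (f := fun D : link_diagram => mu_hat D) _ DE) => {DE}D {}E.
by case=> [/mu_hat_move|/mu_hat_base_point_change].
Qed.
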